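(* Let $\alpha=\tfrac12$ and $\zeta=1-2(2^{1/2}-1)$. There exist $\theta_0>0$, $\beta_0$ and constants $c_0,c_1,c_2>0$ such that for all $0<\theta\le\theta_0$ and all $\beta>\beta_0$ with $\beta\ge \zeta/(2^8\theta^2)$, there is an event of $\mathbb P$-probability at least $1-e^{-c_0/\theta^2}$ on which the $\mu$-probability of the set of configurations $\sigma$ for which the run $\mathcal L_1$ containing the origin satisfies $$\exp\left(\frac{c_1}{\theta^2}\right)\le|\mathcal L_1|\le\exp\left(\frac{c_2}{\theta^2}\right)$$ is at least $1-e^{-c_0/\theta^2}$.
   Context: Random field Ising chain. $(\Omega,\mathcal A,\mathbb P)$ is a probability space carrying i.i.d. random variables $h=(h_i)_{i\in\mathbb Z}$ with $\mathbb P[h_i=1]=\mathbb P[h_i=-1]=\tfrac12$. Spin configurations are $\sigma\in\{-1,+1\}^{\mathbb Z}$. The pair interaction is $J(1)$, a fixed constant assumed large ($J(1)\gg1$), and $J(n)=n^{-2+\alpha}$ for $n>1$ (here $\alpha=1/2$). For finite $\Lambda\subset\mathbb Z$, $\theta>0$ and boundary configuration $\eta$, $$H^\eta(\sigma_\Lambda)=\tfrac12\sum_{(i,j)\in\Lambda\times\Lambda}J(|i-j|)(1-\sigma_i\sigma_j)-\theta\sum_{i\in\Lambda}h_i\sigma_i+\sum_{i\in\Lambda}\sum_{j\notin\Lambda}J(|i-j|)(1-\sigma_i\eta_j),$$ and $\mu^\eta_\Lambda(\sigma_\Lambda)=e^{-\beta H^\eta(\sigma_\Lambda)}/Z^\eta_\Lambda$.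 For $\mathbb P$-a.e. $h$ there is a unique infinite-volume Gibbs measure, denoted $\mu$. A run is a maximal set of consecutive sites on which $\sigma$ is constant; $\mathcal L_1$ denotes the run containing the origin. *)

(* Defs.v *)
From HB Require Import structures.
From mathcomp Require Import all_boot all_order all_algebra.
From mathcomp Require Import all_classical all_reals all_analysis.
Set Implicit Arguments. Unset Strict Implicit. Unset Printing Implicit Defensive.
Import Order.TTheory GRing.Theory Num.Theory numFieldNormedType.Exports.
Local Open Scope classical_set_scope.
Local Open Scope ring_scope.

Definition spin {R : realType} (b : bool) : R := if b then 1 else -1.

Definition alpha {R : realType} : R := 2^-1.

(* J(0) is irrelevant (it is multiplied by 1 - s_i^2 = 0); J(1) = J1; J(n) = n^{-2+alpha}. *)
Definition Jc {R : realType} (J1 : R) (n : nat) : R :=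
  if n == 0%N then 0 else if n == 1%N then J1 else (n%:R) `^ (-2 + alpha).

Definition zeta {R : realType} : R := 1 - 2 * (Num.sqrt 2 - 1).

Definition zdist (i j : int) : nat := `|i - j|%N.

Definition zsum {R : realType} (f : int -> R) : R :=
  limn (series (fun k : nat => f k%:Z)) + limn (series (fun k : nat => f (- (k.+1)%:Z))).

(* Finite volume Lambda given as a duplicate-free list of sites;
   a configuration on Lambda is a finite function 'I_(size Lambda) -> bool,
   the spin at site nth 0 Lambda k being s k (true = +1). *)
Definition ext (L : seq int) (s : {ffun 'I_(size L) -> bool}) (eta : int -> bool)
  : int -> bool :=
  fun i => match @insub nat (fun k => k < size L)%N _ (index i L) with
           | Some k => s k | None => eta i end.

Definition hamiltonian {R : realType} (J1 theta : R) (h : int -> R) (L : seq int)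
  (eta : int -> bool) (s : {ffun 'I_(size L) -> bool}) : R :=
  let sg := fun i => spin (ext s eta i) : R in
  2^-1 * (\sum_(i <- L) \sum_(j <- L) Jc J1 (zdist i j) * (1 - sg i * sg j))
  - theta * (\sum_(i <- L) h i * sg i)
  + \sum_(i <- L) zsum (fun j => if j \in L then 0
                               else Jc J1 (zdist i j) * (1 - sg i * spin (eta j))).

Definition gweight {R : realType} (J1 theta beta : R) (h : int -> R) (L : seq int)
  (eta : int -> bool) (s : {ffun 'I_(size L) -> bool}) : R :=
  expR (- beta * hamiltonian J1 theta h eta s).

Definition mu_fv {R : realType} (J1 theta beta : R) (h : int -> R) (L : seq int)
  (eta : int -> bool) (A : set (int -> bool)) : R :=
  (\sum_(s : {ffun 'I_(size L) -> bool}) gweight J1 theta beta h eta s * \1_A (ext s eta))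
  / (\sum_(s : {ffun 'I_(size L) -> bool}) gweight J1 theta beta h eta s).

Definition cylinders : set (set (int -> bool)) :=
  [set A | exists L : seq int, forall s t : int -> bool,
      (forall i, i \in L -> s i = t i) -> (A s <-> A t)].

Definition Config := g_sigma_algebraType cylinders.

Definition is_gibbs {R : realType} (J1 theta beta : R) (h : int -> R)
  (mu : probability Config R) : Prop :=
  forall L : seq int, uniq L -> forall A : set Config, measurable A ->
    mu A = (\int[mu]_eta (mu_fv J1 theta beta h L eta A)%:E)%E.

Definition run0_len (sg : int -> bool) (n : nat) : Prop :=
  exists l r : int, [/\ l <= 0 <= r, r - l + 1 = n%:Z,
    (forall i, l <= i <= r -> sg i = sg 0),
    sg (l - 1) != sg 0 & sg (r + 1) != sg 0].

Definition indep_rvs {R : realType} {d} {Om : measurableType d}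
  (P : probability Om R) (h : int -> Om -> R) : Prop :=
  forall (F : seq int) (B : int -> set R), uniq F -> (forall i, measurable (B i)) ->
    P (\bigcap_(i in [set` F]) (h i @^-1` B i)) =
    (\prod_(i <- F) fine (P (h i @^-1` B i)))%:E.

Definition iid_sym_pm1 {R : realType} {d} {Om : measurableType d}
  (P : probability Om R) (h : int -> Om -> R) : Prop :=
  [/\ forall i, measurable_fun setT (h i),
      indep_rvs P h,
      forall i, P (h i @^-1` [set 1]) = (2^-1)%:E
    & forall i, P (h i @^-1` [set -1]) = (2^-1)%:E].

(* Main.v *)
(** If the run of the origin is short, then among the runs reached by passing
    repeatedly to a strictly shorter neighbour there is one, at polynomial
    distance, that is not longer than its two neighbours. Flipping such a run of
    length [n] lowers the interaction energy by at least [16 zeta sqrt n], even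
    if all spins beyond the two neighbours agree with it: the interaction of an
    interval of length [n] with a half-line is about [4 sqrt n], of which the
    part beyond distance [n] is [4 (sqrt 2 - 1) sqrt n]. By a Chernoff bound,
    with probability [1 - exp (- c / theta^2)] the field energy of every interval
    within distance [exp (c1 / theta^2)] is at most half of this, so a union
    bound over the [exp (O(c1) / theta^2)] possible runs is beaten by
    [exp (- beta * 8 * zeta)]. Conversely, within [exp (c2 / theta^2)] sites on
    either side of the origin there are intervals of length about
    [256 / theta^2] on which the field is constantly [+1], and others on which
    it is constantly [-1]; the field energy on them exceeds the largest possible
    interaction energy across their boundary, so that the spins follow the field
    somewhere in each, and no run can extend past them. *)
Require Import Defs.
From HB Require Import structures.
From mathcomp Require Import all_boot all_order all_algebra.
From mathcomp Require Import all_classical all_reals all_analysis.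
From mathcomp Require Import ring lra zify.
Set Implicit Arguments.
Unset Strict Implicit.
Unset Printing Implicit Defensive.
Import Order.TTheory GRing.Theory Num.Theory numFieldNormedType.Exports.
Local Open Scope classical_set_scope.
Local Open Scope ring_scope.

(** * Estimates on the couplings *)

Section RealEstimates.
Context {R : realType}.
Implicit Types n r : nat.

Lemma sqrt_natS n : 0 < Num.sqrt (n.+1%:R : R).
Proof. by rewrite sqrtr_gt0 ltr0n. Qed.

Lemma sqr_sqrt_nat n : Num.sqrt (n%:R : R) ^+ 2 = n%:R.
Proof. by rewrite sqr_sqrtr. Qed.

Lemma le_sqrt_nat (m n : nat) : (m <= n)%N ->
  Num.sqrt (m%:R : R) <= Num.sqrt (n%:R : R).
Proof. by move=> mn; rewrite ler_wsqrtr // ler_nat. Qed.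

Lemma JcE (J1 : R) n : (1 < n)%N -> Jc J1 n = (Num.sqrt (n%:R : R) ^+ 3)^-1.
Proof.
move=> n1; rewrite /Jc !gtn_eqF //; last exact: ltnW.
have n0 : (n%:R : R) != 0 by rewrite pnatr_eq0 -lt0n ltnW.
rewrite powRD; last by rewrite n0 implybT.
rewrite -powR12_sqrt ?ler0n// /alpha.
rewrite powRN powR_mulrn ?ler0n// powR12_sqrt ?ler0n//.
have s0 : Num.sqrt (n%:R : R) != 0 by rewrite sqrtr_eq0 -ltNge ltr0n ltnW.
rewrite -{1}(sqr_sqrt_nat n); field.
exact: s0.
Qed.

Lemma Jc_ge0 (J1 : R) n : 0 <= J1 -> 0 <= Jc J1 n.
Proof.
by move=> J0; rewrite /Jc; case: ifP => // _; case: ifP => // _; exact: powR_ge0.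
Qed.

(** Discrete form of the fact that [- 2 / sqrt r] has derivative [r^(-3/2)]: as
    [(b - a) * (b + a) = 1], the middle term is [2 / (a * b * (a + b))]. *)
Lemma inv_sqrt_diff (a b : R) : 0 < a -> a <= b -> b ^+ 2 = a ^+ 2 + 1 ->
  (b ^+ 3)^-1 <= 2 * (a^-1 - b^-1) <= (a ^+ 3)^-1.
Proof.
move=> a0 ab e; have b0 : 0 < b by exact: lt_le_trans ab.
have -> : 2 * (a^-1 - b^-1) = 2 / (a * b * (a + b)).
  have h : (b - a) * (b + a) = 1 by rewrite -subr_sqr e; ring.
  have -> : 2 * (a^-1 - b^-1) = 2 * ((b - a) * (b + a)) / (a * b * (a + b)).
    by field; rewrite !lt0r_neq0 // addr_gt0.
  by rewrite h mulr1.
have p : 0 < a * b * (a + b) by rewrite !mulr_gt0 // addr_gt0.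
apply/andP; split.
  rewrite ler_pdivlMr // mulrC ler_pdivrMr ?exprn_gt0//.
  rewrite !exprS expr0 mulr1.
  have : a * b <= b * b by rewrite ler_wpM2r // ltW.
  have : 0 <= a * b by rewrite mulr_ge0 // ltW.
  move=> h1 h2; nra.
rewrite ler_pdivrMr // mulrC ler_pdivlMr ?exprn_gt0//.
rewrite !exprS expr0 mulr1.
have : a * a <= a * b by rewrite ler_wpM2l // ltW.
have : 0 <= a * a by rewrite mulr_ge0 // ltW.
move=> h1 h2; nra.
Qed.

Lemma sqrt_diff (a b : R) : 0 <= a -> a < b -> b ^+ 2 = a ^+ 2 + 1 ->
  2 / b <= 4 * (b - a) /\ (0 < a -> 4 * (b - a) <= 2 / a).
Proof.
move=> a0 ab e; have b0 : 0 < b by exact: le_lt_trans ab.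
have h : (b - a) * (b + a) = 1 by rewrite -subr_sqr e; ring.
split.
  rewrite ler_pdivrMr //; nra.
move=> ap; rewrite ler_pdivlMr //; nra.
Qed.

(* Discrete primitives of the coupling: the differences of [tailU] dominate [Jc] and
   those of [tailW] are dominated by it, so that sums of couplings telescope. *)
Definition tailU (J1 : R) (r : nat) : R :=
  if (r <= 1)%N then J1 + 2 else 2 / Num.sqrt r.-1%:R.

Definition tailW (J1 : R) (r : nat) : R :=
  if (r <= 1)%N then J1 + 1 else 2 / Num.sqrt r%:R.

Lemma tailU_ge0 (J1 : R) r : 0 <= J1 -> 0 <= tailU J1 r.
Proof.
move=> J0; rewrite /tailU; case: ifP => _; first by rewrite addr_ge0.
by rewrite divr_ge0 // sqrtr_ge0.
Qed.

Lemma Jc_le_tailU (J1 : R) r : (0 < r)%N -> Jc J1 r <= tailU J1 r - tailU J1 r.+1.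
Proof.
case: r => // -[_|r _].
  by rewrite /Jc /tailU /= sqrtr1 divr1 addrK.
rewrite JcE // /tailU /=.
have := @inv_sqrt_diff (Num.sqrt r.+1%:R) (Num.sqrt r.+2%:R).
rewrite !sqr_sqrt_nat => /(_ (sqrt_natS _) (le_sqrt_nat (leqnSn _))).
rewrite natr1 => /(_ erefl) /andP[h _].
by rewrite (le_trans h) // mulrBr.
Qed.

Lemma tailW_le_Jc (J1 : R) r : (0 < r)%N -> tailW J1 r - tailW J1 r.+1 <= Jc J1 r.
Proof.
case: r => // -[_|r _].
  rewrite /Jc /tailW /=.
  (* At [r = 1] the claim is [J1 + 1 - 2 / sqrt 2 <= J1]. *)
  have s2 : Num.sqrt (2 : R) <= 2.
    rewrite -[leRHS]ger0_norm // -sqrtr_sqr ler_sqrt //; nra.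
  suff : 1 <= 2 / Num.sqrt (2 : R) by lra.
  by rewrite ler_pdivlMr ?mul1r // sqrtr_gt0.
rewrite JcE // /tailW /=.
have := @inv_sqrt_diff (Num.sqrt r.+2%:R) (Num.sqrt r.+3%:R).
rewrite !sqr_sqrt_nat => /(_ (sqrt_natS _) (le_sqrt_nat (leqnSn _))).
rewrite natr1 => /(_ erefl) /andP[_ h].
by rewrite (le_trans _ h) // mulrBr.
Qed.

Lemma sqrt_natS_diff n :
  2 / Num.sqrt (n.+1%:R : R) <= 4 * (Num.sqrt n.+1%:R - Num.sqrt n%:R) /\
  ((0 < n)%N -> 4 * (Num.sqrt (n.+1%:R : R) - Num.sqrt n%:R) <= 2 / Num.sqrt n%:R).
Proof.
have := @sqrt_diff (Num.sqrt n%:R) (Num.sqrt n.+1%:R).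
rewrite !sqr_sqrt_nat natr1 sqrtr_ge0 ltr_sqrt ?ltr0n // ltr_nat ltnSn.
move=> /(_ erefl erefl erefl) [h1 h2]; split => // n0; apply: h2.
by rewrite sqrtr_gt0 ltr0n.
Qed.

Lemma sum_inv_sqrt_le (m n : nat) :
  \sum_(k < n) 2 / Num.sqrt ((m + k).+1%:R : R)
    <= 4 * (Num.sqrt (m + n)%:R - Num.sqrt m%:R).
Proof.
elim: n => [|n IH]; first by rewrite big_ord0 addn0 subrr mulr0.
rewrite big_ord_recr /= addnS; have [h _] := sqrt_natS_diff (m + n).
lra.
Qed.

Lemma sum_inv_sqrt_ge (n : nat) :
  4 * (Num.sqrt n.+1%:R - 1) <= \sum_(k < n) 2 / Num.sqrt (k.+1%:R : R).
Proof.
elim: n => [|n IH]; first by rewrite big_ord0 sqrtr1 subrr mulr0.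
rewrite big_ord_recr /=; have [_ /(_ isT) h] := sqrt_natS_diff n.+1.
lra.
Qed.

(** Controls the interaction of an interval of length [n] with an adjacent half-line: a site at
    distance [k.+1] from the half-line contributes at most [tailU J1 k.+1]. *)
Lemma sum_tailU (J1 : R) n : 0 <= J1 ->
  \sum_(k < n) tailU J1 k.+1 <= J1 + 2 + 4 * Num.sqrt n%:R.
Proof.
move=> J0; case: n => [|n].
  by rewrite big_ord0 !addr_ge0 // mulr_ge0 // sqrtr_ge0.
rewrite big_ord_recl /= {1}/tailU /= lerD2l.
have := sum_inv_sqrt_le 0 n; rewrite sqrtr0 subr0 add0n => h.
apply: (le_trans (le_trans _ h)); last by rewrite ler_pM2l // le_sqrt_nat.
by apply: ler_sum => k _.
Qed.

Lemma sqrt2_nat n : Num.sqrt ((n + n)%:R : R) = Num.sqrt 2 * Num.sqrt n%:R.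
Proof. by rewrite addnn -mul2n natrM sqrtrM. Qed.

(* The [-2 * (sqrt 2 - 1)] in [zeta] is, in units of [4 * sqrt n], twice the
   interaction of an interval of length [n] with everything beyond an adjacent
   interval of length [n]. *)
Lemma sum_local_min (J1 : R) n : (0 < n)%N ->
  J1 - 9 + 4 * zeta * Num.sqrt n%:R <=
  \sum_(k < n) (tailW J1 k.+1 - tailW J1 (k.+1 + n) - tailU J1 (k.+1 + n)).
Proof.
move=> n0; rewrite !big_split /= !sumrN.
(* The first term [tailW J1 1] exceeds [2 / sqrt 1] by [J1 - 1]. *)
have h1 : J1 - 1 + 4 * (Num.sqrt n.+1%:R - 1) <= \sum_(k < n) tailW J1 k.+1.
  have := sum_inv_sqrt_ge n; case: n n0 => // n _.
  rewrite !big_ord_recl /= /tailW /= sqrtr1 divr1.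
  move=> h; rewrite -addrA -!natr1; move: h; rewrite -!natr1; lra.
have h2 : \sum_(k < n) tailW J1 (k.+1 + n) <= 4 * (Num.sqrt (n + n)%:R - Num.sqrt n%:R).
  apply: le_trans (sum_inv_sqrt_le n n); apply: ler_sum => k _.
  rewrite /tailW ifF; last lia.
  by have -> : (k.+1 + n = (n + k).+1)%N by lia.
(* [tailU] lags by one index, which costs the extra [4] through [sqrt n <= sqrt n.-1 + 1]. Together
   with [h1] the constants add up to [J1 - 9]. *)
have h3 : \sum_(k < n) tailU J1 (k.+1 + n) <=
    4 * (Num.sqrt (n + n)%:R - Num.sqrt n%:R) + 4.
  have := sum_inv_sqrt_le n.-1 n => h.
  apply: (le_trans (le_trans _ h)).
    apply: ler_sum => k _; rewrite /tailU ifF; last lia.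
    by have -> : ((k.+1 + n).-1 = (n.-1 + k).+1)%N by lia.
  have : Num.sqrt ((n.-1 + n)%:R : R) <= Num.sqrt (n + n)%:R.
    by apply: le_sqrt_nat; lia.
  have : Num.sqrt (n%:R : R) <= Num.sqrt n.-1%:R + 1.
    have s0 : 0 <= Num.sqrt (n.-1%:R : R) by exact: sqrtr_ge0.
    rewrite -[leRHS]ger0_norm ?addr_ge0 // -sqrtr_sqr ler_sqrt ?exprn_ge0 ?addr_ge0 //.
    rewrite sqrrD1 sqr_sqrt_nat.
    have -> : (n%:R : R) = n.-1%:R + 1 by rewrite natr1 prednK.
    by rewrite lerD2r lerDl mulrn_wge0.
  lra.
have h4 : Num.sqrt (n%:R : R) <= Num.sqrt n.+1%:R by apply: le_sqrt_nat.
rewrite sqrt2_nat in h2 h3.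
rewrite /zeta; nra.
Qed.

Lemma zeta_gt0 : 0 < (zeta : R).
Proof.
rewrite /zeta; suff : Num.sqrt (2 : R) < 3 / 2 by lra.
rewrite -[ltRHS]ger0_norm // -?sqrtr_sqr ?ltr_sqrt //; nra.
Qed.

Lemma zeta_le1 : (zeta : R) <= 1.
Proof.
rewrite /zeta; suff : 1 <= Num.sqrt (2 : R) by lra.
by rewrite -[leLHS]sqrtr1 ler_sqrt // ler1n.
Qed.

End RealEstimates.

(** * Energy of an interval *)

Section InfiniteSums.
Context {R : realType}.

Lemma tailU_anti (J1 : R) (m n : nat) : 0 <= J1 -> (m <= n)%N ->
  tailU J1 n <= tailU J1 m.
Proof.
move=> J0; elim: n => [|n IH]; first by rewrite leqn0 => /eqP ->.
rewrite leq_eqVlt => /predU1P[->//|]; rewrite ltnS => /IH; apply: le_trans.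
case: n {IH} => // n.
by rewrite -subr_ge0 (le_trans _ (Jc_le_tailU J1 (ltn0Sn n))) // Jc_ge0.
Qed.

Lemma sum_telescope (V : int -> R) (K : nat) :
  \sum_(0 <= k < K) (V k%:Z - V (k%:Z + 1)) +
  \sum_(0 <= k < K) (V (- k.+1%:Z) - V (- k.+1%:Z + 1)) = V (- K%:Z) - V K%:Z.
Proof.
elim: K => [|K IH]; first by rewrite !big_geq // oppr0 addr0 subrr.
rewrite !big_nat_recr //= addrACA IH.
have -> : - K.+1%:Z + 1 = - K%:Z by lia.
have -> : K%:Z + 1 = K.+1%:Z by lia.
ring.
Qed.

(** [zsum] is a sum of two limits, informative only when both exist. Domination by the differences
    of [V] bounds the partial sums, and nonnegativity makes them monotone, hence convergent. *)
Lemma zsum_bounds (f V : int -> R) (C : R) :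
  (forall j, 0 <= f j) -> (forall j, f j <= V j - V (j + 1)) ->
  (forall K : nat, V (- K%:Z) - V K%:Z <= C) ->
  zsum f <= C /\
  forall K, \sum_(0 <= k < K) f k%:Z + \sum_(0 <= k < K) f (- k.+1%:Z) <= zsum f.
Proof.
move=> f0 fV VC.
set s1 := series (fun k : nat => f k%:Z).
set s2 := series (fun k : nat => f (- k.+1%:Z)).
have s10 K : 0 <= s1 K by apply: sumr_ge0.
have s20 K : 0 <= s2 K by apply: sumr_ge0.
have sC K : s1 K + s2 K <= C.
  apply: le_trans (VC K); rewrite -sum_telescope lerD //.
    by apply: ler_sum => k _; exact: fV.
  by apply: ler_sum => k _; exact: fV.
have nd1 : nondecreasing_seq s1 by apply: nondecreasing_series => k _ _.
have nd2 : nondecreasing_seq s2 by apply: nondecreasing_series => k _ _.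
have c1 : cvgn s1.
  apply: nondecreasing_is_cvgn => //; exists C => _ [K _ <-].
  by apply: le_trans (sC K); rewrite lerDl.
have c2 : cvgn s2.
  apply: nondecreasing_is_cvgn => //; exists C => _ [K _ <-].
  by apply: le_trans (sC K); rewrite lerDr.
split; last first.
  by move=> K; rewrite /zsum lerD // nondecreasing_cvgn_le.
rewrite /zsum -limD //; apply: limr_le; first exact: is_cvgD.
by apply: nearW => K; exact: sC.
Qed.

End InfiniteSums.

(** * Intervals of sites and constant configurations on them *)

Definition block (l : int) (n : nat) : seq int := [seq l + k%:Z | k <- iota 0 n].

Lemma mem_block l n i : (i \in block l n) = (l <= i < l + n%:Z).
Proof.
apply/mapP/idP => [[k]|h]; first by rewrite mem_iota => h ->; lia.
by exists `|i - l|%N; rewrite ?mem_iota; lia.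
Qed.

Lemma block_uniq l n : uniq (block l n).
Proof. by rewrite map_inj_uniq ?iota_uniq // => x y; lia. Qed.

Lemma size_block l n : size (block l n) = n.
Proof. by rewrite size_map size_iota. Qed.

Lemma sum_block (V : nmodType) l n (F : int -> V) :
  \sum_(i <- block l n) F i = \sum_(k < n) F (l + k%:Z).
Proof. by rewrite big_map -{1}(subn0 n) big_mkord. Qed.

Lemma sum_rev_ord (V : nmodType) n (F : nat -> V) :
  \sum_(k < n) F (n - k)%N = \sum_(k < n) F k.+1.
Proof.
rewrite (reindex_inj rev_ord_inj) /=; apply: eq_bigr => k _.
by rewrite subKn.
Qed.

Lemma ext_const (L : seq int) b eta i :
  ext ([ffun=> b] : {ffun 'I_(size L) -> bool}) eta i = if i \in L then b else eta i.
Proof.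
rewrite /ext -index_mem; case: insubP => [k -> _|/negbTE ->] //.
by rewrite ffunE.
Qed.

Lemma ext_nth (L : seq int) (s : {ffun 'I_(size L) -> bool}) eta (k : 'I_(size L)) :
  uniq L -> ext s eta (nth 0 L k) = s k.
Proof.
move=> uL; rewrite /ext index_uniq //.
by case: insubP => [k' _ /val_inj ->|] //; rewrite ltn_ord.
Qed.

Lemma ext_eq_const (L : seq int) (s : {ffun 'I_(size L) -> bool}) b eta :
  uniq L -> (forall i, i \in L -> ext s eta i = b) -> s = [ffun=> b].
Proof.
move=> uL h; apply/ffunP => k; rewrite ffunE -(ext_nth s eta k uL).
exact/h/mem_nth.
Qed.

(** * Energy gained by flipping an interval *)

Section EnergyGap.
Context {R : realType}.

Lemma spinM_same b : spin b * spin b = 1 :> R.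
Proof. by case: b; rewrite /spin ?mulrNN mulr1. Qed.

Lemma spinM_neg b : spin b * spin (~~ b) = -1 :> R.
Proof. by case: b; rewrite /spin /= ?mulNr mul1r. Qed.

Lemma spinN b : spin (~~ b) = - spin b :> R.
Proof. by case: b; rewrite /spin /= ?opprK. Qed.

Lemma spinM_bounds b c : 0 <= 1 - (spin b : R) * spin c <= 2.
Proof. by case: b; case: c; rewrite /spin; lra. Qed.

Definition env (J1 : R) (l : int) (n : nat) (b : bool) (eta : int -> bool) (i j : int) : R :=
  if j \in block l n then 0 else Jc J1 (zdist i j) * (1 - spin b * spin (eta j)).

Lemma hamiltonian_const (J1 theta : R) h l n b eta :
  hamiltonian J1 theta h eta ([ffun=> b] : {ffun 'I_(size (block l n)) -> bool}) =
  - theta * spin b * (\sum_(i <- block l n) h i)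
  + \sum_(i <- block l n) zsum (env J1 l n b eta i).
Proof.
rewrite /hamiltonian big1_seq ?mulr0 ?add0r; last first.
  move=> i /= iL; rewrite big1_seq // => j /= jL.
  by rewrite !ext_const iL jL spinM_same subrr mulr0.
congr (_ + _).
  rewrite -mulrA mulNr; congr (- (_ * _)); rewrite mulr_sumr.
  by apply: eq_big_seq => i iL; rewrite ext_const iL mulrC.
by apply: eq_big_seq => i iL; rewrite ext_const iL.
Qed.

Lemma env_ge0 (J1 : R) l n b eta i j : 0 <= J1 -> 0 <= env J1 l n b eta i j.
Proof.
move=> J0; rewrite /env; case: ifP => // _.
by rewrite mulr_ge0 ?Jc_ge0 //; case/andP: (spinM_bounds b (eta j)).
Qed.

Lemma env_le (J1 : R) l n b eta i j : 0 <= J1 ->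
  env J1 l n b eta i j <= 2 * Jc J1 (zdist i j).
Proof.
move=> J0; rewrite /env; case: ifP => _; first by rewrite mulr_ge0 // Jc_ge0.
by rewrite mulrC ler_wpM2r ?Jc_ge0 //; case/andP: (spinM_bounds b (eta j)).
Qed.

(** Here [m] is the width of a margin on each side that agrees with the interval and so costs
    nothing. Beyond it every spin is allowed to disagree; the nearest such sites are at distances
    [n - k + m] and [k.+1 + m]. *)
Lemma zsum_env_bounds (J1 : R) (l : int) (n m : nat) b (eta : int -> bool) (k : nat) : 0 <= J1 -> (k < n)%N ->
  (forall j : int, l - m%:Z <= j < l + n%:Z + m%:Z -> j \notin block l n -> eta j = b) ->
  let f := env J1 l n b eta (l + k%:Z) in
  zsum f <= 2 * tailU J1 (n - k + m) + 2 * tailU J1 (k.+1 + m) /\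
  forall K, \sum_(0 <= k < K) f k%:Z + \sum_(0 <= k < K) f (- k.+1%:Z) <= zsum f.
Proof.
move=> J0 kn hb; set i := l + k%:Z => f.
(* Both distances are frozen over the interval and its margins, where the summand vanishes, so that
   the potential is constant there. The shift in [zdist (i + 1) j] makes its drop at a site [j]
   further left equal to [2 * (tailU J1 d - tailU J1 d.+1)] with [d = zdist i j]. *)
pose U (j : int) := if l + n%:Z + m%:Z <= j then zdist j i else (n - k + m)%N.
pose W (j : int) := if j <= l - m%:Z then zdist (i + 1) j else (k.+1 + m)%N.
apply: (zsum_bounds (V := fun j => 2 * tailU J1 (U j) - 2 * tailU J1 (W j))).
- by move=> j; exact: env_ge0.
- move=> j; have [c1|c1] := boolP (l + n%:Z + m%:Z <= j).
    have -> : W j = W (j + 1) by rewrite /W !ifF; lia.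
    have -> : U j = zdist i j by rewrite /U /zdist ifT //; lia.
    have -> : U (j + 1) = (zdist i j).+1 by rewrite /U /zdist ifT; lia.
    have : f j <= _ := env_le l n b eta i j J0.
    have r0 : (0 < zdist i j)%N by rewrite /zdist /i; lia.
    have := Jc_le_tailU J1 r0; lra.
  have [c2|c2] := boolP (j < l - m%:Z).
    have -> : U j = U (j + 1).
      rewrite /U (negbTE c1); case: ifP => // c3; lia.
    have -> : W j = (zdist i j).+1 by rewrite /W /zdist ifT; lia.
    have -> : W (j + 1) = zdist i j by rewrite /W /zdist ifT; lia.
    have : f j <= _ := env_le l n b eta i j J0.
    have r0 : (0 < zdist i j)%N by rewrite /zdist /i; lia.
    have := Jc_le_tailU J1 r0; lra.
  have -> : U j = U (j + 1).
    rewrite /U (negbTE c1); case: ifP => // c3; rewrite /zdist /i; lia.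
  have -> : W j = W (j + 1).
    rewrite /W; case: ifP => c3; case: ifP => c4 //; rewrite /zdist /i; lia.
  rewrite subrr /f /env; case: ifPn => // c3.
  by rewrite (hb j) ?spinM_same ?subrr ?mulr0 //; lia.
- move=> K; have : tailU J1 (U (- K%:Z)) <= tailU J1 (n - k + m).
    by apply: tailU_anti => //; rewrite /U; case: ifP => // c; rewrite /zdist /i; lia.
  have : tailU J1 (W K%:Z) <= tailU J1 (k.+1 + m).
    by apply: tailU_anti => //; rewrite /W; case: ifP => // c; rewrite /zdist /i; lia.
  have := tailU_ge0 (U K%:Z) J0; have := tailU_ge0 (W (- K%:Z)) J0.
  lra.
Qed.

Lemma zsum_env_ge (J1 : R) (l : int) (n : nat) b (eta : int -> bool) (k : nat) : 0 <= J1 -> (k < n)%N ->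
  (forall j : int, l - n%:Z <= j < l + n%:Z + n%:Z -> j \notin block l n -> eta j = ~~ b) ->
  2 * (tailW J1 (n - k) - tailW J1 (n - k + n)) +
  2 * (tailW J1 k.+1 - tailW J1 (k.+1 + n)) <= zsum (env J1 l n b eta (l + k%:Z)).
Proof.
move=> J0 kn hb; set i := l + k%:Z.
(* Large enough for the window from [- K] to [K] to contain the interval and both neighbouring
   intervals of length [n]. *)
pose K := (absz l + n + n + n)%N.
have [|_ /(_ K)] := @zsum_env_bounds J1 l n 0 b eta k J0 kn.
  by move=> j; rewrite mem_block; lia.
apply: le_trans; set f := env _ _ _ _ _ _.
(* The distances are now frozen also beyond the two neighbouring intervals, so the potential varies
   only where the spins are known to disagree. *)
pose U (j : int) := if j <= l + n%:Z then (n - k)%N else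
            if j <= l + n%:Z + n%:Z then zdist j i else (n - k + n)%N.
pose W (j : int) := if j <= l - n%:Z then (k.+1 + n)%N else
            if j <= l then zdist (i + 1) j else k.+1.
pose V (j : int) := 2 * tailW J1 (U j) - 2 * tailW J1 (W j).
have -> : 2 * (tailW J1 (n - k) - tailW J1 (n - k + n)) +
  2 * (tailW J1 k.+1 - tailW J1 (k.+1 + n)) = V (- K%:Z) - V K%:Z.
  rewrite /V.
  have -> : U (- K%:Z) = (n - k)%N by rewrite /U ifT // /K; lia.
  have -> : U K%:Z = (n - k + n)%N by rewrite /U !ifF // /K; lia.
  have -> : W (- K%:Z) = (k.+1 + n)%N by rewrite /W ifT // /K; lia.
  have -> : W K%:Z = k.+1 by rewrite /W !ifF // /K; lia.
  ring.
suff fV j : V j - V (j + 1) <= f j.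
  by rewrite -sum_telescope lerD //; apply: ler_sum => ? _; exact: fV.
have f0 : 0 <= f j by exact: env_ge0.
have fE : l - n%:Z <= j < l + n%:Z + n%:Z -> j \notin block l n ->
    f j = 2 * Jc J1 (zdist i j).
  move=> c1 c2; rewrite /f /env (negbTE c2) hb // spinM_neg; ring.
rewrite /V; have [c1|c1] := boolP (l + n%:Z <= j < l + n%:Z + n%:Z).
  have -> : W j = W (j + 1) by rewrite /W !ifF; lia.
  have -> : U j = zdist i j.
    rewrite /U /zdist; case: ifP => c2; [|case: ifP => c3]; rewrite /zdist /i; lia.
  have -> : U (j + 1) = (zdist i j).+1 by rewrite /U /zdist ifF ?ifT; rewrite /zdist /i; lia.
  rewrite fE; [|lia|by rewrite mem_block; lia].
  have r0 : (0 < zdist i j)%N by rewrite /zdist /i; lia.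
  have := tailW_le_Jc J1 r0; lra.
have -> : U j = U (j + 1).
  by rewrite /U; do ![case: ifP => ?] => //; rewrite /zdist /i; lia.
have [c2|c2] := boolP (l - n%:Z <= j < l).
  have -> : W j = (zdist i j).+1.
    rewrite /W /zdist; case: ifP => c3; [|case: ifP => c4]; rewrite /zdist /i; lia.
  have -> : W (j + 1) = zdist i j by rewrite /W /zdist ifF ?ifT; rewrite /zdist /i; lia.
  rewrite fE; [|lia|by rewrite mem_block; lia].
  have r0 : (0 < zdist i j)%N by rewrite /zdist /i; lia.
  have := tailW_le_Jc J1 r0; lra.
have -> : W j = W (j + 1).
  by rewrite /W; do ![case: ifP => ?] => //; rewrite /zdist /i; lia.
by rewrite subrr.
Qed.

(** Before the flip all sites within distance [n] disagree with the interval; after it they agree,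
    and at worst everything beyond disagrees. The factor [4] comes from two sides and from
    [1 - s * s' = 2] for opposite spins. *)
Lemma energy_gap_local_min (J1 theta : R) (h : int -> R) (l : int) (n : nat) b (eta : int -> bool) : 0 <= J1 -> (0 < n)%N ->
  (forall j : int, l - n%:Z <= j < l + n%:Z + n%:Z -> j \notin block l n -> eta j = ~~ b) ->
  4 * (J1 - 9 + 4 * zeta * Num.sqrt n%:R)
    - 2 * theta * spin b * (\sum_(i <- block l n) h i) <=
  hamiltonian J1 theta h eta ([ffun=> b] : {ffun 'I_(size (block l n)) -> bool})
  - hamiltonian J1 theta h eta ([ffun=> ~~ b] : {ffun 'I_(size (block l n)) -> bool}).
Proof.
move=> J0 n0 hb; rewrite !hamiltonian_const spinN.
set S := \sum_(i <- block l n) h i.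
have -> : forall A B : R, - theta * spin b * S + A - (- theta * - spin b * S + B) =
  A - B - 2 * theta * spin b * S by move=> A B; ring.
rewrite lerD2r -sumrB sum_block.
apply: (@le_trans _ _ (\sum_(k < n) (2 * (tailW J1 (n - k) - tailW J1 (n - k + n) - tailU J1 (n - k + n)) +
   2 * (tailW J1 k.+1 - tailW J1 (k.+1 + n) - tailU J1 (k.+1 + n))))).
  rewrite big_split /= -!mulr_sumr.
  rewrite (sum_rev_ord n (fun r => tailW J1 r - tailW J1 (r + n) - tailU J1 (r + n))).
  have := sum_local_min J1 n0; lra.
apply: ler_sum => k _.
have [h1 _] := @zsum_env_bounds J1 l n n (~~ b) eta k J0 (ltn_ord k) hb.
have := @zsum_env_ge J1 l n b eta k J0 (ltn_ord k) hb.
lra.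
Qed.

(** Nothing is known about the surroundings: the boundary energy before the flip is at least [0],
    and after it at most the full interaction with both half-lines. *)
Lemma energy_gap_block (J1 theta : R) (h : int -> R) (l : int) (n : nat) b (eta : int -> bool) : 0 <= J1 ->
  - (2 * theta * spin b * (\sum_(i <- block l n) h i))
    - 4 * (J1 + 2 + 4 * Num.sqrt n%:R) <=
  hamiltonian J1 theta h eta ([ffun=> b] : {ffun 'I_(size (block l n)) -> bool})
  - hamiltonian J1 theta h eta ([ffun=> ~~ b] : {ffun 'I_(size (block l n)) -> bool}).
Proof.
move=> J0; rewrite !hamiltonian_const spinN.
set S := \sum_(i <- block l n) h i.
have -> : forall A B : R, - theta * spin b * S + A - (- theta * - spin b * S + B) =
  - (2 * theta * spin b * S) - (B - A) by move=> A B; ring.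
rewrite lerB // -sumrB sum_block.
apply: (@le_trans _ _ (\sum_(k < n) (2 * tailU J1 (n - k) + 2 * tailU J1 k.+1))); last first.
  rewrite big_split /= -!mulr_sumr (sum_rev_ord n (tailU J1)).
  have := sum_tailU n J0; lra.
apply: ler_sum => k _.
have hv c (j : int) : l - 0%:Z <= j < l + n%:Z + 0%:Z -> j \notin block l n -> eta j = c.
  by rewrite mem_block; lia.
have [h1 _] := @zsum_env_bounds J1 l n 0 (~~ b) eta k J0 (ltn_ord k) (hv _).
have [_ /(_ 0%N)] := @zsum_env_bounds J1 l n 0 b eta k J0 (ltn_ord k) (hv _).
rewrite !big_geq // addr0 => h2; rewrite !addn0 in h1; lra.
Qed.

End EnergyGap.

(** * Gibbs measures *)

Section Measure.
Context {R : realType}.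
Local Open Scope ereal_scope.

(** Stated without measurability of [f], so as to apply directly to [mu_fv] as a function of the
    boundary condition. The integral is a supremum over simple functions below [f], which are also
    below [c]. *)
Lemma integral_le_bound d (T : measurableType d) (mu : probability T R)
    (f : T -> R) (c : R) : (forall x, (0 <= f x <= c)%R) ->
  \int[mu]_x (f x)%:E <= c%:E.
Proof.
move=> fc; have c0 : (0 <= c)%R.
  by have /andP[h1 h2] := fc point; exact: le_trans h2.
have -> : c%:E = \int[mu]_x cst c%:E x.
  by rewrite integral_cst //; have := probability_setT mu => /= ->; rewrite mule1.
rewrite !ge0_integralTE //; last first.
  by move=> x; rewrite lee_fin; case/andP: (fc x).
apply: le_ereal_sup => _ [g /= gf <-]; exists g => //= x.
by apply: (le_trans (gf x)); rewrite lee_fin; case/andP: (fc x).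
Qed.

Lemma measure_split_le d (T : measurableType d) (P : probability T R) (A B : set T) :
  measurable A -> measurable B -> P A <= P B + P (A `\` B).
Proof.
move=> mA mB; have mD : measurable (A `\` B) by exact: measurableD.
apply: (@le_trans _ _ (P (B `|` (A `\` B)))); last exact: measureU2.
rewrite le_measure ?inE //; first exact: measurableU.
by move=> x Ax; have [?|?] := pselect (B x); [left|right].
Qed.

Lemma union_bound d (T : measurableType d) (P : probability T R) (I : eqType)
    (s : seq I) (B : I -> set T) (c : I -> R) (A : set T) :
  measurable A -> (forall i, i \in s -> measurable (B i)) ->
  (forall i, i \in s -> P (B i) <= (c i)%:E) ->
  (forall x, A x -> exists2 i, i \in s & B i x) ->
  P A <= (\sum_(i <- s) c i)%R%:E.
Proof.
elim: s A => [|i s IH] A mA mB Pc sub.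
  rewrite big_nil [A](_ : _ = set0) ?measure0 //.
  by apply/seteqP; split => // x /sub[].
have mBi : measurable (B i) by apply: mB; rewrite mem_head.
apply: (le_trans (measure_split_le P mA mBi)).
rewrite big_cons EFinD leeD //; first by apply: Pc; rewrite mem_head.
apply: IH; first exact: measurableD.
- by move=> j js; apply: mB; rewrite in_cons js orbT.
- by move=> j js; apply: Pc; rewrite in_cons js orbT.
move=> x [/sub[j]]; rewrite in_cons => /predU1P[-> //|js] Bj _.
by exists j.
Qed.

End Measure.

(** * Gibbs probabilities bounded by flipping an interval *)

Section GibbsBounds.
Context {R : realType}.

Lemma measurable_cylinder (L : seq int) (A : set Config) :
  (forall s t : int -> bool, (forall i, i \in L -> s i = t i) -> A s -> A t) ->
  measurable A.
Proof.
move=> h; apply: sub_sigma_algebra; exists L => s t st; split; first exact: h.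
by apply: h => i /st.
Qed.

(** Peierls argument: on [A] only the constant configuration [b] contributes to the numerator, while
    the partition function is at least the weight of the flipped one. *)
Lemma mu_fv_flip_le (J1 theta beta : R) (h : int -> R) (L : seq int) b
    (A : set (int -> bool)) (D : R) (eta : int -> bool) :
  uniq L -> 0 <= beta ->
  (forall sg, A sg -> forall i, i \in L -> sg i = b) ->
  (A (ext ([ffun=> b] : {ffun 'I_(size L) -> bool}) eta) ->
   D <= hamiltonian J1 theta h eta ([ffun=> b] : {ffun 'I_(size L) -> bool})
        - hamiltonian J1 theta h eta ([ffun=> ~~ b] : {ffun 'I_(size L) -> bool})) ->
  0 <= mu_fv J1 theta beta h L eta A <= expR (- beta * D).
Proof.
move=> uL b0 Ab AD; rewrite /mu_fv.
set w := gweight J1 theta beta h eta.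
have w0 s : 0 <= w s by exact: expR_ge0.
have sw0 : 0 <= \sum_s w s by apply: sumr_ge0.
have w1 : w [ffun=> ~~ b] <= \sum_s w s.
  by rewrite (bigD1 [ffun=> ~~ b]) //= lerDl sumr_ge0.
have swp : 0 < \sum_s w s by apply: lt_le_trans w1; exact: expR_gt0.
rewrite divr_ge0 //=; last first.
  by apply: sumr_ge0 => s _; rewrite mulr_ge0 // indicE; case: (_ \in _).
rewrite (bigD1 [ffun=> b]) //= [X in _ + X]big1 ?addr0; last first.
  move=> s sb; rewrite indicE; case: (boolP (_ \in _)) => [|_]; last by rewrite mulr0.
  rewrite inE => /Ab sA; case/negP: sb; apply/eqP; exact: ext_eq_const sA.
rewrite ler_pdivrMr // indicE; case: (boolP (_ \in _)) => [|_]; last first.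
  by rewrite mulr0 mulr_ge0 // expR_ge0.
rewrite inE mulr1 => /AD gap.
apply: (@le_trans _ _ (expR (- beta * D) * w [ffun=> ~~ b])); last first.
  by rewrite ler_wpM2l // expR_ge0.
rewrite /w /gweight -expRD ler_expR !mulNr -opprD lerN2 -mulrDr ler_wpM2l //.
by rewrite -lerBrDr.
Qed.

Lemma gibbs_flip_le (J1 theta beta : R) (h : int -> R) (mu : probability Config R)
    (L : seq int) b (A : set Config) (D : R) :
  is_gibbs J1 theta beta h mu -> uniq L -> 0 <= beta -> measurable A ->
  (forall sg : Config, A sg -> forall i, i \in L -> sg i = b) ->
  (forall eta : int -> bool, A (ext ([ffun=> b] : {ffun 'I_(size L) -> bool}) eta) ->
   D <= hamiltonian J1 theta h eta ([ffun=> b] : {ffun 'I_(size L) -> bool})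
        - hamiltonian J1 theta h eta ([ffun=> ~~ b] : {ffun 'I_(size L) -> bool})) ->
  (mu A <= (expR (- beta * D))%:E)%E.
Proof.
move=> G uL b0 mA Ab AD; rewrite (G L uL A mA).
by apply: integral_le_bound => eta; exact: (mu_fv_flip_le uL b0 Ab (AD eta)).
Qed.

(** The block is a run whose two neighbouring runs are at least as long. *)
Definition local_min_run (l : int) (n : nat) (b : bool) (sg : int -> bool) : Prop :=
  (forall i, i \in block l n -> sg i = b) /\
  (forall j, l - n%:Z <= j < l + n%:Z + n%:Z -> j \notin block l n -> sg j = ~~ b).

Lemma measurable_local_min_run l n b :
  measurable ([set sg | local_min_run l n b sg] : set Config).
Proof.
apply: (@measurable_cylinder (block (l - n%:Z) (n + n + n))) => s t st [h1 h2].
split=> [i iL|j jn jL].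
  by rewrite -st ?h1 //; move: iL; rewrite !mem_block; lia.
by rewrite -st ?h2 // mem_block; lia.
Qed.

(** The field takes back at most [8 * zeta * sqrt n] of the interaction gain [16 * zeta * sqrt n],
    and [1 <= sqrt n]. *)
Lemma gibbs_local_min_run_le (J1 theta beta : R) (h : int -> R)
    (mu : probability Config R) l n b :
  is_gibbs J1 theta beta h mu -> 0 <= beta -> 9 <= J1 -> (0 < n)%N ->
  theta * `|\sum_(i <- block l n) h i| <= 4 * zeta * Num.sqrt n%:R -> 0 <= theta ->
  (mu [set sg | local_min_run l n b sg] <= (expR (- beta * (8 * zeta)))%:E)%E.
Proof.
move=> G b0 J9 n0 hS t0.
apply: (gibbs_flip_le (b := b) G (block_uniq l n) b0 (measurable_local_min_run l n b)).
  by move=> sg [h1 _].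
move=> eta [_ h2].
have J0 : 0 <= J1 by lra.
have := @energy_gap_local_min _ J1 theta h l n b eta J0 n0.
have h2' : forall j : int, l - n%:Z <= j < l + n%:Z + n%:Z -> j \notin block l n ->
   eta j = ~~ b.
  by move=> j c1 c2; have := h2 j c1 c2; rewrite ext_const (negbTE c2).
move=> /(_ h2'); apply: le_trans.
have s1 : 1 <= Num.sqrt (n%:R : R) by rewrite -[leLHS]sqrtr1 ler_sqrt ?ler0n // ler1n.
have z0 := @zeta_gt0 R.
have : theta * spin b * \sum_(i <- block l n) h i <= theta * `|\sum_(i <- block l n) h i|.
  rewrite -mulrA ler_wpM2l // (le_trans (ler_norm _)) // normrM.
  by rewrite /spin; case: (b); rewrite ?normrN normr1 mul1r.
have : zeta <= zeta * Num.sqrt (n%:R : R) by rewrite ler_peMr // ltW.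
move=> h3 h4; lra.
Qed.

Definition const_on (l : int) (n : nat) (b : bool) (sg : int -> bool) : Prop :=
  forall i, i \in block l n -> sg i = b.

Lemma measurable_const_on l n b :
  measurable ([set sg | const_on l n b sg] : set Config).
Proof.
apply: (@measurable_cylinder (block l n)) => s t st h i iL.
by rewrite -st ?h.
Qed.

Lemma gibbs_const_on_le (J1 theta beta : R) (h : int -> R)
    (mu : probability Config R) l n b :
  is_gibbs J1 theta beta h mu -> 0 <= beta -> 0 <= J1 ->
  (forall i, i \in block l n -> h i = spin (~~ b)) ->
  1 <= 2 * theta * n%:R - 4 * (J1 + 2 + 4 * Num.sqrt n%:R) ->
  (mu [set sg | const_on l n b sg] <= (expR (- beta))%:E)%E.
Proof.
move=> G b0 J0 hb gap; rewrite -[- beta]mulr1.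
apply: (gibbs_flip_le (b := b) G (block_uniq l n) b0 (measurable_const_on l n b)) => //.
move=> eta _; have := @energy_gap_block _ J1 theta h l n b eta J0.
apply: le_trans.
have -> : \sum_(i <- block l n) h i = spin (~~ b) * n%:R.
  rewrite (eq_big_seq (fun=> spin (~~ b)) hb) big_const_seq count_predT size_block.
  by rewrite iter_addr_0 mulr_natr.
have -> : 2 * theta * spin b * (spin (~~ b) * n%:R) = - (2 * theta * n%:R) :> R.
  have -> : 2 * theta * spin b * (spin (~~ b) * n%:R) =
    2 * theta * n%:R * (spin b * spin (~~ b)) by ring.
  by rewrite spinM_neg; ring.
lra.
Qed.

End GibbsBounds.

(** * The random field *)

Section Field.
Context {R : realType} d (Om : measurableType d) (P : probability Om R)
  (h : int -> Om -> R) (iid : iid_sym_pm1 P h).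

Definition pattern (F : seq int) (e : int -> bool) : set Om :=
  \bigcap_(i in [set` F]) (h i @^-1` [set spin (e i)]).

Lemma measurable_field_eq i (x : R) : measurable (h i @^-1` [set x]).
Proof.
by case: iid => mh _ _ _; rewrite -[_ @^-1` _]setTI; apply: mh => //; exact: measurable_set1.
Qed.

Lemma measurable_pattern F e : measurable (pattern F e).
Proof.
rewrite /pattern bigcap_seq; apply: big_ind => //.
- exact: measurableI.
- by move=> i _; exact: measurable_field_eq.
Qed.

Lemma prob_spin i b : P (h i @^-1` [set spin b]) = (2^-1)%:E.
Proof. by case: iid => _ _ p m; case: b; rewrite /spin. Qed.

Lemma prob_pattern F e : uniq F -> P (pattern F e) = (2^-1 ^+ size F)%:E.
Proof.
move=> uF; case: (iid) => _ ind _ _.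
rewrite /pattern (ind F (fun i => [set spin (e i)])) //.
congr EFin; under eq_bigr do rewrite prob_spin /=.
by rewrite big_const_seq count_predT iter_mulr_1.
Qed.

(** [K] consecutive disjoint blocks of length [n] are examined from [l] on. The iterated set
    difference suits an induction that computes the probability. *)
Fixpoint no_const_block (b : bool) (l : int) (n K : nat) : set Om :=
  if K is K'.+1 then
    no_const_block b l n K' `\` pattern (block (l + (K' * n)%N%:Z) n) (fun=> b)
  else setT.

Lemma measurable_no_const_block b l n K : measurable (no_const_block b l n K).
Proof.
elim: K => [|K IH] /=; first exact: measurableT.
by apply: measurableD => //; exact: measurable_pattern.
Qed.

Lemma notin_no_const_block b l n K om : ~ no_const_block b l n K om ->
  exists l' : int, l <= l' /\ l' + n%:Z <= l + (K * n)%N%:Z /\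
    forall i, i \in block l' n -> h i om = spin b.
Proof.
elim: K => [|K IH] /= nK; first by case: nK.
have [gK|/IH[l' [h1 [h2 h3]]]] := pselect (no_const_block b l n K om); last first.
  by exists l'; split => //; split => //; lia.
exists (l + (K * n)%N%:Z); split; first lia.
split; first lia.
move=> i iB; apply: contrapT => hi; apply: nK; split => // /(_ i iB) /=.
exact: hi.
Qed.

Lemma pattern_cat F F' e : pattern (F ++ F') e = pattern F e `&` pattern F' e.
Proof. by rewrite /pattern !bigcap_seq big_cat. Qed.

(* Independence of the blocks enters through the extra pattern, which makes
   the induction on the number of blocks go through. *)
Lemma prob_no_const_block_pattern b l n K F : uniq F ->
  (forall i, i \in F -> l + (K * n)%N%:Z <= i) ->
  P (no_const_block b l n K `&` pattern F (fun=> b)) =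
  ((1 - 2^-1 ^+ n) ^+ K * 2^-1 ^+ size F)%:E.
Proof.
elim: K F => [|K IH] F uF hF /=.
  by rewrite setTI prob_pattern // expr0 mul1r.
set B := block (l + (K * n)%N%:Z) n.
have uBF : uniq (B ++ F).
  rewrite cat_uniq block_uniq uF andbT /=; apply/hasPn => i /hF.
  by rewrite mem_block; lia.
(* Both events on the right have the shape covered by the induction hypothesis. *)
have e : (no_const_block b l n K `\` pattern B (fun=> b)) `&` pattern F (fun=> b) =
  (no_const_block b l n K `&` pattern F (fun=> b)) `\`
  (no_const_block b l n K `&` pattern (B ++ F) (fun=> b)).
  rewrite pattern_cat; apply/seteqP; split => x /=.
    by move=> [[gx nB] Fx]; split => // -[_ [Bx _]].
  by move=> [[gx Fx] nB]; split => //; split => // Bx; apply: nB.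
have m1 F' : measurable (no_const_block b l n K `&` pattern F' (fun=> b)).
  by apply: measurableI; [exact: measurable_no_const_block|exact: measurable_pattern].
have PD X Y : measurable X -> measurable Y -> P (X `\` Y) = (P X - P (X `&` Y))%E.
  move=> mX mY; apply: measureD => //.
  by rewrite (le_lt_trans (probability_le1 _ _)) // ltry.
rewrite e PD //.
have -> : (no_const_block b l n K `&` pattern F (fun=> b)) `&`
  (no_const_block b l n K `&` pattern (B ++ F) (fun=> b)) =
  no_const_block b l n K `&` pattern (B ++ F) (fun=> b).
  by apply/setIidPr => x; rewrite pattern_cat => -[gx [_ Fx]].
rewrite !IH //.
- rewrite -EFinB size_cat size_block; congr EFin; rewrite exprD exprS; ring.
- by move=> i; rewrite mem_cat mem_block => /orP[|/hF]; lia.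
- by move=> i /hF; lia.
Qed.

(** [(1 - 2^-n)^(4^n) <= exp (- 2^n) <= exp (- n)]. *)
Lemma prob_no_const_block b l n :
  (P (no_const_block b l n (4 ^ n)) <= (expR (- n%:R))%:E)%E.
Proof.
have := @prob_no_const_block_pattern b l n (4 ^ n) [::] isT.
rewrite {1}/pattern bigcap_seq big_nil setIT => -> //.
rewrite expr0 mulr1 lee_fin.
have p1 : 2^-1 ^+ n <= 1 :> R by apply: exprn_ile1; lra.
apply: (@le_trans _ _ (expR (- 2^-1 ^+ n) ^+ (4 ^ n))).
  by rewrite lerXn2r ?nnegrE ?subr_ge0 ?expR_ge0 // expR_ge1Dx.
rewrite -expRM_natr ler_expR mulNr lerN2.
have -> : (4 ^ n)%:R = 2 ^+ n * 2 ^+ n :> R by rewrite natrX -exprMn -natrM.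
rewrite mulrA -exprMn mulVf // expr1n mul1r -natrX ler_nat.
exact/ltnW/ltn_expl.
Qed.

(** * Chernoff bound for sums of the field *)

Lemma cosh_le (x : R) : x ^+ 2 <= 2^-1 -> expR x + expR (- x) <= 2 * expR (2 * x ^+ 2).
Proof.
move=> hx; have x1 : -1 < x < 1 by nra.
case/andP: x1 => x1 x2.
have le1 (y : R) : y < 1 -> expR y <= (1 - y)^-1.
  move=> y1; rewrite -[expR y]invrK -expRN lef_pV2 ?posrE ?expR_gt0 ?subr_gt0 //.
  exact: expR_ge1Dx.
(* The chain is [2 / (1 - x^2) <= 2 * (1 + 2 * x^2) <= 2 * exp (2 * x^2)], whose first inequality
   needs [x^2 <= 1/2]. *)
apply: (@le_trans _ _ ((1 - x)^-1 + (1 + x)^-1)).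
  by rewrite lerD ?le1 // -[X in 1 + X]opprK le1 // ltrNl.
have -> : (1 - x)^-1 + (1 + x)^-1 = 2 * (1 - x ^+ 2)^-1.
  field; apply/and3P; split; apply: lt0r_neq0; nra.
rewrite ler_pM2l // (@le_trans _ _ (1 + 2 * x ^+ 2)) ?expR_ge1Dx //.
rewrite -ler_pV2 ?inE ?unitfE; last 2 first.
- by apply/andP; split; [apply: lt0r_neq0; nra | nra].
- by apply/andP; split; [apply: lt0r_neq0; rewrite invr_gt0; nra | rewrite invr_gt0; nra].
rewrite invrK -[leLHS]mul1r ler_pdivrMr; nra.
Qed.

Definition pattern_sum (L : seq int) (s : {ffun 'I_(size L) -> bool}) : R :=
  \sum_(i <- L) spin (ext s (fun=> true) i).

Lemma pattern_sumE (L : seq int) s : uniq L ->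
  @pattern_sum L s = \sum_k spin (s k).
Proof.
move=> uL; rewrite /pattern_sum (big_nth 0) big_mkord.
by apply: eq_bigr => k _; rewrite ext_nth.
Qed.

Lemma sum_expR_pattern (L : seq int) (x : R) : uniq L ->
  \sum_(s : {ffun 'I_(size L) -> bool}) expR (x * pattern_sum s) =
  (expR x + expR (- x)) ^+ size L.
Proof.
move=> uL; transitivity (\prod_(k < size L) \sum_(b : bool) expR (x * spin b)).
  rewrite bigA_distr_bigA; apply: eq_bigr => s _.
  by rewrite pattern_sumE // mulr_sumr expR_sum.
rewrite prodr_const card_ord big_bool /= /spin mulr1 mulrN mulr1 //.
Qed.

Lemma measurable_sum_field (L : seq int) (t : R) :
  measurable [set om | t < `|\sum_(i <- L) h i om|].
Proof.
have mS : measurable_fun setT (fun om => `|\sum_(i <- L) h i om|).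
  apply: measurableT_comp => //; apply: measurable_sum => i.
  by case: iid.
have := mS measurableT _ (measurable_itv `]t, +oo[); rewrite setTI.
by congr measurable; apply/seteqP; split => om /=; rewrite in_itv /= andbT.
Qed.

(** The exponential moment is computed by counting: each of the [2^n] sign patterns has probability
    [2^-n], and the sum of [exp (x * S)] over patterns factorizes over sites. *)
Lemma prob_sum_field_gt (L : seq int) (t : R) : uniq L -> 0 < t ->
  (P [set om | (t < `|\sum_(i <- L) h i om|)%R] <=
   (2 * expR (- (t ^+ 2 / (8 * (size L)%:R))))%:E)%E.
Proof.
move=> uL t0; set A := [set om | _]; set n := size L.
have mA : measurable A by exact: measurable_sum_field.
(* The field is [1] or [-1] only almost surely; [N] is the null event where this fails on [L]. *)
pose N := \bigcup_(i in [set` L]) ~` (h i @^-1` [set 1] `|` h i @^-1` [set -1]).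
have mU i : measurable (h i @^-1` [set 1] `|` h i @^-1` [set -1]).
  by apply: measurableU; exact: measurable_field_eq.
have mN : measurable N.
  by rewrite /N bigcup_seq; apply: bigsetU_measurable => i _; exact: measurableC.
have PN : (P N <= 0)%E.
  have := @union_bound R _ _ P _ L _ (fun=> 0) N mN (fun i _ => measurableC (mU i)).
  rewrite big1 //; apply => [i _|x [i iL Nx]]; last by exists i.
  rewrite probability_setC //.
  have -> : P (h i @^-1` [set 1] `|` h i @^-1` [set -1]) =
    (P (h i @^-1` [set 1%R]) + P (h i @^-1` [set (-1)%R]))%E.
    apply: measureU; [exact: measurable_field_eq|exact: measurable_field_eq|].
    apply/seteqP; split => // y /= [-> e].
    by have : (1 : R) <> -1 by lra.
  have -> := prob_spin i true; have -> := prob_spin i false.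
  rewrite -[leLHS]/((1 - (2^-1 + 2^-1))%R%:E) lee_fin; lra.
apply: (le_trans (measure_split_le P mA mN)).
rewrite -[leRHS]add0e leeD //.
pose bad (s : {ffun 'I_n -> bool}) := t < `|pattern_sum s|.
have cover x : (A `\` N) x -> exists2 s, s \in enum bad & pattern L (ext s (fun=> true)) x.
  move=> [Ax nN]; pose s : {ffun 'I_(size L) -> bool} := [ffun k : 'I_(size L) => h (nth 0 L k) x == 1].
  have hs i : i \in L -> h i x = spin (ext s (fun=> true) i).
    move=> iL; have iL' : (index i L < size L)%N by rewrite index_mem.
    have := @ext_nth L s (fun=> true) (Ordinal iL') uL; rewrite /= nth_index // => ->.
    rewrite ffunE /= nth_index //; case: eqP => [->//|ne].
    apply: contrapT => ne'; apply: nN; exists i => //= -[] //.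
  exists s; last by move=> i /hs.
  rewrite mem_enum unfold_in /bad /pattern_sum.
  by rewrite -(eq_big_seq _ hs).
have mAN : measurable (A `\` N) by exact: measurableD.
have := @union_bound R _ _ P _ (enum bad) _ (fun=> 2^-1 ^+ n) _ mAN
  (fun s _ => measurable_pattern _ _) _ cover.
move=> /(_ _)/le_trans; apply => [s _|]; first by rewrite prob_pattern.
rewrite big_enum lee_fin /=.
(* For [n <= t] no pattern is bad; otherwise [x <= 1/4] below, as [cosh_le] requires. *)
have [nt|tn] := leP n%:R t.
  rewrite big_pred0 ?mulr_ge0 ?expR_ge0 // => s; apply/negbTE.
  rewrite -leNgt (le_trans _ nt) // pattern_sumE // (le_trans (ler_norm_sum _ _ _)) //.
  rewrite (eq_bigr (fun=> 1)) ?sumr_const ?card_ord // => k _.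
  by rewrite /spin; case: (s k); rewrite ?normrN normr1.
have n0 : 0 < n%:R :> R by exact: lt_trans tn.
(* The minimizer of [- x * t + 2 * x^2 * n], with value [- t^2 / (8 * n)]. *)
pose x := t / (4 * n%:R).
have x0 : 0 < x by rewrite divr_gt0 // mulr_gt0.
have xn : 4 * (x * n%:R) = t by rewrite /x; field; exact: lt0r_neq0.
have x4 : x <= 4^-1 by nra.
apply: (@le_trans _ _ (\sum_(s : {ffun 'I_n -> bool})
   2^-1 ^+ n * (expR (- x * t) * (expR (x * pattern_sum s) + expR (- x * pattern_sum s))))).
  rewrite big_mkcond /=; apply: ler_sum => s _; case: ifP => [bs|_]; last first.
    by rewrite !mulr_ge0 ?exprn_ge0 ?expR_ge0 ?addr_ge0 ?expR_ge0.
  rewrite ler_peMr ?exprn_ge0 //.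
  rewrite mulrDr -!expRD; move: bs; rewrite unfold_in /bad lter_normr => /orP[bs|bs].
    rewrite -[leLHS]addr0 lerD ?expR_ge0 // -expR0 ler_expR; nra.
  rewrite -[leLHS]add0r lerD ?expR_ge0 // -expR0 ler_expR; nra.
rewrite -!mulr_sumr big_split /= !sum_expR_pattern // opprK [expR (- x) + _]addrC.
rewrite -/n -mulr2n -[(_ ^+ n) *+ 2]mulr_natl.
have hc : (expR x + expR (- x)) ^+ n <= 2 ^+ n * expR (2 * x ^+ 2 * n%:R).
  rewrite expRM_natr -exprMn lerXn2r ?nnegrE ?addr_ge0 ?mulr_ge0 ?expR_ge0 //.
  by apply: cosh_le; nra.
apply: (@le_trans _ _ (2^-1 ^+ n * (expR (- x * t) * (2 * (2 ^+ n * expR (2 * x ^+ 2 * n%:R)))))).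
  apply: ler_wpM2l; first by rewrite exprn_ge0.
  by apply: ler_wpM2l; [exact: expR_ge0|exact: ler_wpM2l].
have -> : forall a b c e : R, a * (b * (2 * (c * e))) = (a * c) * (2 * (b * e)).
  by move=> a b c e; ring.
rewrite -exprMn mulVf // expr1n mul1r ler_pM2l // -expRD ler_expR.
have -> : t ^+ 2 / (8 * n%:R) = 2 * x ^+ 2 * n%:R.
  by rewrite /x; field; exact: lt0r_neq0.
rewrite -xn; nra.
Qed.

End Field.

(** * Runs *)

(** Strong induction on the length, passing to a strictly shorter neighbour while there is one. A
    move shifts the left end by at most [n], and [n + (n - 1)^2 <= n^2] keeps the total displacement
    quadratic. *)
Lemma exists_local_min_run (sg : int -> bool) (n : nat) (l : int) (b : bool) :
  (0 < n)%N -> const_on l n b sg -> sg (l - 1) = ~~ b -> sg (l + n%:Z) = ~~ b ->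
  exists (l' : int) (n' : nat) (b' : bool),
    [/\ (0 < n' <= n)%N, (zdist l' l <= n * n)%N & local_min_run l' n' b' sg].
Proof.
elim/ltn_ind: n l b => n IH l b n0 cb bl br.
(* If the spin [b] returns within distance [n] on the right, the first return [k] is the length of
   the right neighbour. *)
have [/existsP[k0 hk0]|nr] := boolP [exists k : 'I_n, sg (l + n%:Z + k%:Z) == b].
  have ex : exists k, (k < n)%N && (sg (l + n%:Z + k%:Z) == b).
    by exists k0; rewrite ltn_ord.
  case: (ex_minnP ex) => k /andP[kn /eqP hk] kmin.
  have k0' : (0 < k)%N.
    by rewrite lt0n; apply/eqP => k1; move: hk; rewrite k1 addr0 br; case: (b).
  have [|||l' [n' [b' [h1 h2 h3]]]] := IH k kn (l + n%:Z) (~~ b) k0'.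
  - move=> i; rewrite mem_block => hi.
    have [j [jk ->]] : exists j : nat, (j < k)%N /\ i = l + n%:Z + j%:Z.
      by exists (zdist i (l + n%:Z)); rewrite /zdist; split; lia.
    apply: contrapT => hj.
    have /kmin : (j < n)%N && (sg (l + n%:Z + j%:Z) == b).
      by rewrite (ltn_trans jk kn) /=; move: hj; case: (sg _); case: (b).
    by rewrite leqNgt jk.
  - by rewrite negbK; apply: cb; rewrite mem_block; lia.
  - by rewrite negbK.
  exists l', n', b'; split => //; first lia.
  by move: h2; rewrite /zdist; nia.
have [/existsP[k0 hk0]|nl] := boolP [exists k : 'I_n, sg (l - 1 - k%:Z) == b].
  have ex : exists k, (k < n)%N && (sg (l - 1 - k%:Z) == b).
    by exists k0; rewrite ltn_ord.
  case: (ex_minnP ex) => k /andP[kn /eqP hk] kmin.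
  have k0' : (0 < k)%N.
    by rewrite lt0n; apply/eqP => k1; move: hk; rewrite k1 subr0 bl; case: (b).
  have [|||l' [n' [b' [h1 h2 h3]]]] := IH k kn (l - k%:Z) (~~ b) k0'.
  - move=> i; rewrite mem_block => hi.
    have [j [jk ->]] : exists j : nat, (j < k)%N /\ i = l - 1 - j%:Z.
      by exists (zdist (l - 1) i); rewrite /zdist; split; lia.
    apply: contrapT => hj.
    have /kmin : (j < n)%N && (sg (l - 1 - j%:Z) == b).
      by rewrite (ltn_trans jk kn) /=; move: hj; case: (sg _); case: (b).
    by rewrite leqNgt jk.
  - by rewrite negbK -hk; congr sg; lia.
  - rewrite negbK; apply: cb; rewrite mem_block; lia.
  exists l', n', b'; split => //; first lia.
  by move: h2; rewrite /zdist; nia.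
exists l, n, b; split; [by rewrite n0 leqnn|by rewrite /zdist; lia|split => // j jn].
rewrite mem_block => jb.
have [jl|jl] := leP l j.
  have kn : (zdist j (l + n%:Z) < n)%N by rewrite /zdist; lia.
  move: nr; rewrite negb_exists => /forallP /(_ (Ordinal kn)) /=.
  have -> : l + n%:Z + (zdist j (l + n%:Z))%:Z = j by rewrite /zdist; lia.
  by case: (sg j); case: (b).
have kn : (zdist (l - 1) j < n)%N by rewrite /zdist; lia.
move: nl; rewrite negb_exists => /forallP /(_ (Ordinal kn)) /=.
have -> : l - 1 - (zdist (l - 1) j)%:Z = j by rewrite /zdist; lia.
by case: (sg j); case: (b).
Qed.

Lemma exists_run0 (sg : int -> bool) (K : nat) :
  ~ const_on 0 K (sg 0) sg -> ~ const_on (1 - K%:Z) K (sg 0) sg ->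
  exists (l : int) (n : nat),
    [/\ (0 < n <= K + K)%N /\ (l <= 0 < l + n%:Z), run0_len sg n, const_on l n (sg 0) sg,
        sg (l - 1) = ~~ sg 0 & sg (l + n%:Z) = ~~ sg 0].
Proof.
move=> cr cl.
have exr : exists k : nat, (k < K)%N && (sg k%:Z != sg 0).
  apply: contrapT => ne; apply: cr => i; rewrite mem_block => hi.
  apply: contrapT => /eqP hs; apply: ne; exists `|i|%N.
  have -> : `|i|%N%:Z = i by lia.
  by rewrite hs andbT; lia.
have exl : exists k : nat, (k < K)%N && (sg (- k%:Z) != sg 0).
  apply: contrapT => ne; apply: cl => i; rewrite mem_block => hi.
  apply: contrapT => /eqP hs; apply: ne; exists `|i|%N.
  have -> : - `|i|%N%:Z = i by lia.
  by rewrite hs andbT; lia.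
case: (ex_minnP exr) => k /andP[kK hk] kmin.
case: (ex_minnP exl) => k' /andP[kK' hk'] kmin'.
have k0 : (0 < k)%N by case: (k) hk => //; rewrite eqxx.
have k0' : (0 < k')%N by case: (k') hk' => //; rewrite oppr0 eqxx.
have same i : 1 - k'%:Z <= i <= k%:Z - 1 -> sg i = sg 0.
  move=> hi; apply: contrapT => /eqP hs; have [i0|i0] := leP 0 i.
    have := kmin `|i|%N; have -> : `|i|%N%:Z = i by lia.
    by rewrite hs andbT; lia.
  have := kmin' `|i|%N; have -> : - `|i|%N%:Z = i by lia.
  by rewrite hs andbT; lia.
have el : 1 - k'%:Z - 1 = - k'%:Z by lia.
have er : 1 - k'%:Z + (k + k' - 1)%N%:Z = k%:Z by lia.
exists (1 - k'%:Z), (k + k' - 1)%N; split.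
- by split; lia.
- exists (1 - k'%:Z), (k%:Z - 1); split; [lia|lia|exact: same| |].
    by rewrite el.
  by have -> : k%:Z - 1 + 1 = k%:Z by lia.
- by move=> i; rewrite mem_block => hi; apply: same; lia.
- by rewrite el; move: hk'; case: (sg _); case: (sg _).
- by rewrite er; move: hk; case: (sg _); case: (sg _).
Qed.

(** The upper bound [b] makes the event local: the run and the two sites that end it lie in a fixed
    finite window. *)
Lemma measurable_run0_between (R : realType) (a b : R) :
  measurable ([set sg : Config | exists n : nat, run0_len sg n /\ (a <= n%:R <= b)%R]
    : set Config).
Proof.
pose M := Num.truncn b.
apply: (@measurable_cylinder (block (- (M%:Z + 1)) (M + M + 3))) => s t st.
move=> [n [[l [r [h1 h2 h3 h4 h5]]] /andP[an nb]]].
have nM : (n <= M)%N.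
  by rewrite /M truncn_ge_nat //; apply: le_trans nb.
have e i : l - 1 <= i <= r + 1 -> t i = s i.
  by move=> hi; rewrite st // mem_block; lia.
exists n; split; last by rewrite an nb.
exists l, r; split => //; rewrite ?(e 0); try lia.
- by move=> i hi; rewrite (e i) ?h3 //; lia.
- by rewrite (e (l - 1)) //; lia.
- by rewrite (e (r + 1)) //; lia.
Qed.

Lemma const_on_sub (l l' : int) (m n : nat) b (sg : int -> bool) :
  l <= l' -> l' + n%:Z <= l + m%:Z -> const_on l m b sg -> const_on l' n b sg.
Proof. by move=> h1 h2 c i; rewrite mem_block => hi; apply: c; rewrite mem_block; lia. Qed.

(** * Enumeration of the bad events *)

Definition near_origin (N : nat) : seq int := block (- (2 * N ^ 2)%N%:Z) (4 * N ^ 2 + 1).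

(** The run of the origin starts at distance less than [N] and the descent moves by at most [N^2],
    which together stay within [2 * N^2]. *)
Lemma mem_near_origin (N m : nat) (l l' : int) : (0 < m <= N)%N -> l <= 0 < l + m%:Z ->
  (zdist l' l <= m * m)%N -> l' \in near_origin N.
Proof.
move=> mN l0; rewrite /near_origin mem_block /zdist -mulnn => h.
have mm : (m * m <= N * N)%N by apply: leq_mul; lia.
have m1 : (m <= m * m)%N by nia.
lia.
Qed.

(* [inl (l, m, b)] stands for a local minimum run of sign [b] on [block l m], and
   [inr (b, side)] for a run of sign [b] reaching far on one side of the origin. *)
Definition bad_index (N : nat) : seq ((int * nat * bool) + (bool * bool)) :=
  [seq inl (x, b) | x <- [seq (l, m) | l <- near_origin N, m <- iota 1 N],
                    b <- [:: true; false]] ++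
  [seq inr (b, side) | b <- [:: true; false], side <- [:: true; false]].

Lemma size_bad_index N : size (bad_index N) = ((4 * N ^ 2 + 1) * N * 2 + 4)%N.
Proof. by rewrite size_cat !size_allpairs size_block size_iota. Qed.

Lemma mem_bad_index_inl N l m b : l \in near_origin N -> (0 < m <= N)%N ->
  inl (l, m, b) \in bad_index N.
Proof.
move=> hl hm; rewrite mem_cat; apply/orP; left; apply: allpairs_f; last by case: b.
by apply: allpairs_f => //; rewrite mem_iota; lia.
Qed.

Lemma mem_bad_index_inr N b side : inr (b, side) \in bad_index N.
Proof.
by rewrite mem_cat; apply/orP; right; apply: allpairs_f; [case: b|case: side].
Qed.

Lemma bad_index_inl_gt0 N l m b : inl (l, m, b) \in bad_index N -> (0 < m)%N.
Proof.
rewrite mem_cat => /orP[|/allpairsP[[? ?] [_ _ //]]].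
move=> /allpairsP[[[l1 m1] b1] [/= /allpairsP[[l2 m2] /= [_ hm [_ ->]]] _ [_ -> _]]].
by move: hm; rewrite mem_iota => /andP[].
Qed.

(** * Numerical inequalities behind the choice of constants *)

Section Constants.
Context {R : realType}.

(** The number of events is at most [14 * N^3], so the left side is at most
    [224 * exp (- 5/8 * q * X)]. The factor [224] is absorbed by [exp (q * X / 2)], whence [448]. *)
Lemma union_count_le (q X : R) (N : nat) : 448 <= q * X ->
  N%:R <= 2 * expR (q / 8 * X) -> (0 < N)%N ->
  ((4 * N ^ 2 + 1) * N * 2 + 4)%N%:R * (2 * expR (- (q * X))) <= expR (- (q / 8 * X)).
Proof.
move=> qX hN N0.
set e := expR (q / 8 * X); have e0 : 0 < e by exact: expR_gt0.
have cnt : ((4 * N ^ 2 + 1) * N * 2 + 4)%N%:R <= 14 * (N%:R ^+ 3) :> R.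
  by rewrite -natrX -natrM ler_nat; nia.
have cub : N%:R ^+ 3 <= 8 * e ^+ 3 :> R.
  have -> : 8 * e ^+ 3 = (2 * e) ^+ 3 by rewrite !exprS expr0; ring.
  by rewrite lerXn2r ?nnegrE ?mulr_ge0 // ltW.
apply: (@le_trans _ _ (14 * (8 * e ^+ 3) * (2 * expR (- (q * X))))).
  apply: ler_wpM2r; first by rewrite mulr_ge0 // expR_ge0.
  by apply: (le_trans cnt); rewrite ler_pM2l.
have -> : 14 * (8 * e ^+ 3) * (2 * expR (- (q * X))) =
  224 * expR (- (5 / 8 * (q * X))).
  have -> : expR (- (5 / 8 * (q * X))) = e ^+ 3 * expR (- (q * X)).
    by rewrite /e -expRM_natr -expRD; congr expR; field.
  by ring.
have -> : expR (- (q / 8 * X)) = expR (q * X / 2) * expR (- (5 / 8 * (q * X))).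
  by rewrite -expRD; congr expR; field.
rewrite ler_wpM2r ?expR_ge0 //.
by apply: le_trans (expR_ge1Dx _); lra.
Qed.

(** As [theta * sqrt n >= 16], the field term is at least [32 * sqrt n], twice the boundary term
    [16 * sqrt n]. The surplus absorbs [J1] because [sqrt n >= 16 / theta >= 16 * J1]. *)
Lemma flip_block_gap (J1 theta : R) (n : nat) : 9 <= J1 -> 0 < theta ->
  theta * J1 <= 1 -> 256 / theta ^+ 2 <= n%:R ->
  1 <= 2 * theta * n%:R - 4 * (J1 + 2 + 4 * Num.sqrt n%:R).
Proof.
move=> J9 t0 tJ; rewrite ler_pdivrMr ?exprn_gt0 // => hn.
set s := Num.sqrt (n%:R : R); have s0 : 0 <= s by exact: sqrtr_ge0.
have ss : n%:R = s * s by rewrite -expr2 sqr_sqrt_nat.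
have ts0 : 0 <= theta * s by rewrite mulr_ge0 // ltW.
have ts : 16 <= theta * s.
  rewrite -(@ler_pXn2r _ 2) ?nnegrE // exprMn /s sqr_sqrt_nat; nra.
have sJ : 16 * J1 <= s.
  rewrite -(ler_pM2l t0); lra.
have : 16 * s <= theta * s * s by rewrite ler_wpM2r.
rewrite ss; lra.
Qed.

Lemma block_volume_le (n : nat) : (0 < n)%N ->
  (4 ^ n * n + 4 ^ n * n)%N%:R <= expR (16 * n%:R) :> R.
Proof.
move=> n0; apply: (@le_trans _ _ (16 ^ n)%N%:R).
  have h1 : (n <= 2 ^ n)%N by exact/ltnW/ltn_expl.
  have h2 : (2 <= 2 ^ n)%N by rewrite -{1}(expn1 2) leq_pexp2l.
  rewrite ler_nat addnn -muln2 -mulnA.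
  have -> : (16 ^ n = 4 ^ n * (2 ^ n * 2 ^ n))%N by rewrite -!expnMn.
  by rewrite leq_mul2l leq_mul // orbT.
rewrite expRM_natr natrX lerXn2r ?nnegrE ?expR_ge0 //.
by apply: le_trans (expR_ge1Dx _); lra.
Qed.

End Constants.

(** * Union bounds over the field and over the spins *)

Theorem theorem2p2 (R : realType) :
  exists J0 : R, forall J1 : R, J0 <= J1 ->
  forall (d : measure_display) (Om : measurableType d) (P : probability Om R)
         (h : int -> Om -> R),
  iid_sym_pm1 P h ->
  exists theta0 beta0 c0 c1 c2 : R,
    [/\ 0 < theta0, 0 < c0, 0 < c1, 0 < c2 &
    forall theta beta : R,
      0 < theta -> theta <= theta0 -> beta0 < beta ->
      zeta / (2 ^+ 8 * theta ^+ 2) <= beta ->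
      exists E : set Om,
        [/\ measurable E,
            ((1 - expR (- c0 / theta ^+ 2))%:E <= P E)%E
          & forall om, E om ->
              forall mu : probability Config R,
                is_gibbs J1 theta beta (fun i => h i om) mu ->
                ((1 - expR (- c0 / theta ^+ 2))%:E <=
                 mu [set sg : Config | exists n : nat, run0_len sg n /\
                      (expR (c1 / theta ^+ 2) <= n%:R <= expR (c2 / theta ^+ 2))%R])%E]].
Proof.
exists 9 => J1 J9 d Om P h iid.
have z0 := @zeta_gt0 R; have z1 := @zeta_le1 R.
(* A rate common to all bad events. It is dictated by [exp (- beta)] with [beta >= zeta * X / 256]
   and [zeta <= 1]; the other events decay at least as fast. *)
pose q : R := zeta ^+ 2 / 256.
have q0 : 0 < q by rewrite divr_gt0 ?ltr0n ?exprn_gt0.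
have q1 : q <= 1 by rewrite /q; nra.
have J10 : 0 < J1 by lra.
(* This [theta0] ensures [theta * J1 <= 1] and [448 <= q * X]. The rate [q / 8] leaves room for the
   cubic number of events, and [16 * 257] comes from [2 * K <= exp (16 * n)] with [n <= 257 * X]. *)
exists (q / (448 * J1)), 0, (q / 8), (q / 8), (16 * 257).
split; [by rewrite divr_gt0 ?mulr_gt0 ?ltr0n|by rewrite divr_gt0 ?ltr0n|
  by rewrite divr_gt0 ?ltr0n|by rewrite mulr_gt0 ?ltr0n|].
move=> theta beta t0; rewrite ler_pdivlMr ?mulr_gt0 ?ltr0n // => tJq b0 hbeta.
have tJ : theta * J1 <= 1 by nra.
have t1 : theta <= 1 by nra.
pose X := (theta ^+ 2)^-1; have X0 : 0 < X by rewrite invr_gt0 exprn_gt0.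
have Xt : X * theta ^+ 2 = 1 by rewrite mulVf // lt0r_neq0 // exprn_gt0.
have X1 : 1 <= X.
  by rewrite -[leRHS]mul1r ler_pdivlMr ?exprn_gt0 // mul1r expr_le1 // ltW.
have qX : 448 <= q * X.
  rewrite ler_pdivlMr ?exprn_gt0 //; nra.
have zX : zeta * X / 256 <= beta.
  apply: le_trans hbeta; rewrite invfM.
  have -> : (2 ^+ 8 : R) = 256 by rewrite -natrX.
  by rewrite -/X; lra.
have -> : - (q / 8) / theta ^+ 2 = - (q / 8 * X) by rewrite mulNr.
rewrite -/X.
have [N [N0 hN ltN]] : exists N : nat, [/\ (0 < N)%N, N%:R <= 2 * expR (q / 8 * X)
    & forall m : nat, m%:R < expR (q / 8 * X) -> (m <= N)%N].
  exists (Num.truncn (expR (q / 8 * X))).+1; split => // [|m hm].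
    rewrite -natr1 mulr2n mulrDl mul1r lerD ?truncn_le ?expR_ge0 //.
    by rewrite -expR0 ler_expR mulr_ge0 // ltW // divr_gt0.
  by rewrite leqW // truncn_ge_nat ?expR_ge0 // ltW.
have [n [n0 nX Xn]] : exists n : nat, [/\ (0 < n)%N, 256 * X <= n%:R & n%:R <= 257 * X].
  exists (Num.truncn (256 * X)).+1; split => //; first exact/ltW/truncnS_gt.
  have : (Num.truncn (256 * X))%:R <= 256 * X by rewrite truncn_le mulr_ge0 ?ler0n // ltW.
  rewrite -natr1; lra.
pose K := (4 ^ n * n)%N.
pose start (side : bool) : int := if side then 0 else 1 - K%:Z.
pose idx := bad_index N.
(* One estimate serves both union bounds, since field and spin events share the index set [idx]. *)
have total (c : R) : c <= 2 * expR (- (q * X)) ->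
    \sum_(i <- idx) c <= expR (- (q / 8 * X)).
  move=> hc; rewrite big_const_seq count_predT iter_addr_0 -[c *+ _]mulr_natl size_bad_index.
  by apply: (le_trans _ (union_count_le qX hN N0)); rewrite ler_wpM2l.
pose bad (i : (int * nat * bool) + (bool * bool)) : set Om :=
  match i with
  | inl (l, m, _) => [set om | 4 * zeta * Num.sqrt m%:R / theta < `|\sum_(j <- block l m) h j om|]
  | inr (b, side) => no_const_block h b (start side) n (4 ^ n)
  end.
have mbad i : measurable (bad i).
  case: i => [[[l m] b]|[b side]] /=; last exact: measurable_no_const_block iid _ _ _ _.
  exact: measurable_sum_field iid _ _.
have Pbad i : i \in idx -> (P (bad i) <= (2 * expR (- (q * X)))%:E)%E.
  case: i => [[[l m] b]|[b side]] /=.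
    move=> /bad_index_inl_gt0 m0.
    have sm : 0 < Num.sqrt (m%:R : R) by rewrite sqrtr_gt0 ltr0n.
    have := prob_sum_field_gt iid (block_uniq l m)
      (t := 4 * zeta * Num.sqrt m%:R / theta).
    rewrite !divr_gt0 ?mulr_gt0 // => /(_ isT) /le_trans; apply.
    rewrite lee_fin ler_pM2l // ler_expR lerN2 size_block.
    have -> : (4 * zeta * Num.sqrt m%:R / theta) ^+ 2 / (8 * m%:R) = 2 * zeta ^+ 2 * X.
      rewrite -[Y in 8 * Y](sqr_sqrt_nat m) /X; field.
      by apply/andP; split; exact: lt0r_neq0.
    rewrite ler_pM2r // /q; nra.
  move=> _; apply: (le_trans (prob_no_const_block iid b (start side) n)).
  rewrite lee_fin -[leLHS]mul1r ler_pM ?expR_ge0 ?ler1n // ler_expR lerN2.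
  by apply: le_trans nX; rewrite ler_pM2r //; lra.
pose B := \bigcup_(i in [set` idx]) bad i.
have mB : measurable B by rewrite /B bigcup_seq; exact: bigsetU_measurable.
have PB : (P B <= (expR (- (q / 8 * X)))%:E)%E.
  apply: (le_trans (union_bound mB (fun i _ => mbad i) Pbad _)).
    by move=> x [i iI bx]; exists i.
  by rewrite lee_fin total.
exists (~` B); split; first exact: measurableC.
  by rewrite probability_setC // EFinB leeB.
move=> om nB mu G.
(* For this [om], each window contains a block where the field opposes the sign [y.1]; [pos] selects
   one. *)
have goodblock (y : bool * bool) : exists l' : int,
    start y.2 <= l' /\ l' + n%:Z <= start y.2 + K%:Z /\
    forall i, i \in block l' n -> h i om = spin (~~ y.1).
  case: y => b side /=; apply: notin_no_const_block => nb.
  by apply: nB; exists (inr (~~ b, side)) => //=; exact: mem_bad_index_inr.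
have [pos hpos] := choice goodblock.
pose badc (i : (int * nat * bool) + (bool * bool)) : set Config :=
  match i with
  | inl (l, m, b) => [set sg | local_min_run l m b sg]
  | inr y => [set sg | const_on (pos y) n y.1 sg]
  end.
set T := [set sg : Config | _].
have mT : measurable T by exact: measurable_run0_between.
have bd0 : 0 <= beta by exact: ltW.
suff muT : (mu (~` T) <= (expR (- (q / 8 * X)))%:E)%E.
  have -> : mu T = (1 - mu (~` T))%E by rewrite -probability_setC ?setCK //; exact: measurableC.
  by rewrite EFinB leeB.
have mbadc i : measurable (badc i).
  case: i => [[[l m] b]|y] /=; last exact: measurable_const_on.
  exact: measurable_local_min_run.
apply: (@le_trans _ _ (\sum_(i <- idx) (2 * expR (- (q * X))))%:E); last first.
  by rewrite lee_fin total.
apply: (union_bound (measurableC mT) (fun i _ => mbadc i)).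
  move=> i; case: i => [[[l m] b]|y] /= iI.
    have m0 := bad_index_inl_gt0 iI.
    have := @gibbs_local_min_run_le _ J1 theta beta (fun i => h i om) mu l m b G bd0 J9 m0.
    have hS : theta * `|\sum_(j <- block l m) h j om| <= 4 * zeta * Num.sqrt m%:R.
      rewrite mulrC -ler_pdivlMr // leNgt; apply/negP => hb.
      by apply: nB; exists (inl (l, m, b)).
    move=> /(_ hS (ltW t0)) /le_trans; apply.
    rewrite lee_fin -[leLHS]mul1r ler_pM ?expR_ge0 ?ler1n // ler_expR mulNr lerN2 /q.
    nra.
  have [h1 [h2 h3]] := hpos y.
  have gap : 1 <= 2 * theta * n%:R - 4 * (J1 + 2 + 4 * Num.sqrt n%:R).
    exact: flip_block_gap.
  apply: (le_trans (gibbs_const_on_le G bd0 (ltW J10) h3 gap)).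
  rewrite lee_fin -[leLHS]mul1r ler_pM ?expR_ge0 ?ler1n // ler_expR lerN2 /q.
  nra.
move=> sg nT.
(* A spin constant on a whole window is constant on the opposing block selected there. *)
have inr_cover side : const_on (start side) K (sg 0) sg ->
    exists2 i, i \in idx & badc i sg.
  move=> cs; exists (inr (sg 0, side)); first exact: mem_bad_index_inr.
  have [/= h1 [h2 _]] := hpos (sg 0, side).
  exact: const_on_sub cs.
have [cr|cr] := pselect (const_on 0 K (sg 0) sg); first exact: (inr_cover true).
have [cl|cl] := pselect (const_on (1 - K%:Z) K (sg 0) sg); first exact: (inr_cover false).
have [l [m [[/andP[m0 mK] l0] run cm ml mr]]] := exists_run0 cr cl.
(* The run has length at most [2 * K], hence obeys the upper bound; outside [T] it must violate the
   lower one. *)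
have mN : (m <= N)%N.
  apply: ltN; rewrite ltNge; apply/negP => hm; apply: nT; exists m; split => //.
  rewrite hm /=; apply: (@le_trans _ _ (K + K)%:R); first by rewrite ler_nat.
  by apply: (le_trans (block_volume_le n0)); rewrite ler_expR -/X; lra.
have [l' [m' [b' [h1 h2 h3]]]] := exists_local_min_run m0 cm ml mr.
exists (inl (l', m', b')) => //; case/andP: h1 => m0' mm'.
apply: mem_bad_index_inl; last by rewrite m0' (leq_trans mm').
by apply: mem_near_origin h2; rewrite ?m0.
Qed.
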